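(* Let $(\mathcal G,\underline a)$ be a finite metric graph and let $A,B\in\mathrm{Hom}(\mathcal K)$ define regular but not quasi-sectorial boundary conditions. Then there exists a constant $C>0$ such that $$\big\|(-\Delta(A,B)+\kappa^2)^{-1}\big\|\ge\frac{C}{\kappa}\qquad\text{as }\kappa\to\infty,$$ that is, for all sufficiently large $\kappa>0$.
   Context: A finite metric graph $(\mathcal G,\underline a)$ consists of finite sets of vertices, of internal edges $\mathcal I$ and of external edges $\mathcal E$ (each internal edge has an initial and a terminal vertex, each external edge has one initial vertex), where each $i\in\mathcal I$ is identified with an interval $I_i=[0,a_i]$, $a_i>0$, and each $e\in\mathcal E$ with $I_e=[0,\infty)$; $\underline a=\{a_i\}_{i\in\mathcal I}$. Set $L^2(\mathcal G,\underline a)=\bigoplus_{j\in\mathcal I\cup\mathcal E}L^2(I_j;\mathbb C)$ and $H^2(\mathcal G,\underline a)=\bigoplus_{j\in\mathcal I\cup\mathcal E}H^2(I_j;\mathbb C)$; derivatives are taken edgewise. Let $d=|\mathcal E|+2|\mathcal I|$ and $\mathcal K=\mathbb C^{|\mathcal E|}\oplus\mathbb C^{|\mathcal I|}\oplus\mathbb C^{|\mathcal I|}\cong\mathbb C^d$; $\mathrm{Hom}(\mathcal K)$ denotes the linear maps $\mathcal K\to\mathcal K$. For $\psi\in H^2(\mathcal G,\underline a)$ define the trace vectors in $\mathcal K$ $$\underline\psi=\big(\{\psi_e(0)\}_{e\in\mathcal E},\{\psi_i(0)\}_{i\in\mathcal I},\{\psi_i(a_i)\}_{i\in\mathcal I}\big),\qquad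 \underline\psi'=\big(\{\psi_e'(0)\}_{e\in\mathcal E},\{\psi_i'(0)\}_{i\in\mathcal I},\{-\psi_i'(a_i)\}_{i\in\mathcal I}\big).$$ For $A,B\in\mathrm{Hom}(\mathcal K)$, the operator $\Delta(A,B)$ in $L^2(\mathcal G,\underline a)$ is $\Delta(A,B)\psi=\psi''$ with domain $\{\psi\in H^2(\mathcal G,\underline a): A\underline\psi+B\underline\psi'=0\}$. The boundary conditions defined by $A,B$ are called regular if $\mathrm{Rank}(A\ B)=d$ and $\det(A+\lambda B)\neq0$ for some $\lambda\in\mathbb C$. For regular boundary conditions there exist (quasi-Weierstrass normal form) $0\le m\le d$, invertible $F,G\in\mathbb C^{d\times d}$, a matrix $L\in\mathbb C^{m\times m}$ and a nilpotent matrix $N_B\in\mathbb C^{(d-m)\times(d-m)}$ with $$A=F\begin{bmatrix}L&0\\0&\mathds 1_{\mathbb C^{d-m}}\end{bmatrix}G,\qquad B=F\begin{bmatrix}\mathds 1_{\mathbb C^{m}}&0\\0&N_B\end{bmatrix}G .$$ Here $\mathds 1$ denotes the identity. The boundary conditions are called quasi-sectorial if they are regular and $N_B=0$ in this normal form (the case $m=d$, in which the second block is absent, is included). For regular boundary conditions $-\kappa^2$ belongs to the resolvent set of $-\Delta(A,B)$ for all sufficiently large $\kappa>0$. *)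

(* Defs.v *)
From HB Require Import structures.
From mathcomp Require Import all_boot all_order all_algebra.
From mathcomp Require Import all_classical all_reals all_analysis.
From mathcomp Require Import complex.

Set Implicit Arguments.
Unset Strict Implicit.
Unset Printing Implicit Defensive.

Import Order.TTheory GRing.Theory Num.Theory.
Import numFieldNormedType.Exports.

Local Open Scope classical_set_scope.
Local Open Scope ring_scope.
Local Open Scope complex_scope.

Record metric_graph (R : realType) := MetricGraph {
  vertex : finType;
  internal : finType;
  external : finType;
  initial : internal -> vertex;
  terminal : internal -> vertex;
  external_initial : external -> vertex;
  edge_length : internal -> R;
  edge_length_gt0 : forall i, 0 < edge_length i }.

Definition edge (R : realType) (Gr : metric_graph R) : finType :=
  (external Gr + internal Gr)%type.

Definition edge_itv (R : realType) (Gr : metric_graph R) (j : edge Gr) : set R :=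
  match j with
  | inl _ => `[0, +oo[
  | inr i => `[0, edge_length i]
  end.

Definition edge_int (R : realType) (Gr : metric_graph R) (j : edge Gr) : set R :=
  match j with
  | inl _ => `]0, +oo[
  | inr i => `]0, edge_length i[
  end.

Section Sobolev.
Variable R : realType.
Implicit Types (D : set R) (f g : R -> R[i]) (u v phi : R -> R).

Definition square_integrable D f :=
  [/\ measurable_fun D (fun x => complex.Re (f x)),
      measurable_fun D (fun x => complex.Im (f x)) &
      (lebesgue_measure (R := R)).-integrable D
        (fun x => (Normc.normc (f x) ^+ 2)%:E)].

Definition test_function D phi :=
  (forall n x, derivable (derive1n n phi) x 1) /\
  exists2 K, compact K /\ K `<=` D & forall x, ~ K x -> phi x = 0.

(* Real-valued test functions suffice, complex ones being their complex-linear
   combinations. *)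
Definition weak_derivative_real D u v :=
  forall phi, test_function D phi ->
    \int[lebesgue_measure]_(x in D) (u x * derive1 phi x) =
    - \int[lebesgue_measure]_(x in D) (v x * phi x).

Definition weak_derivative D f g :=
  weak_derivative_real D (fun x => complex.Re (f x)) (fun x => complex.Re (g x)) /\
  weak_derivative_real D (fun x => complex.Im (f x)) (fun x => complex.Im (g x)).

Definition continuous_on D f :=
  {within D, continuous (fun x => complex.Re (f x))} /\
  {within D, continuous (fun x => complex.Im (f x))}.

End Sobolev.

Section Laplacian.
Variables (R : realType) (Gr : metric_graph R).

(* Elements of L^2(G) are represented by functions, of which only the values
   almost everywhere on the intervals [edge_itv j] matter. *)
Definition edge_fun := edge Gr -> R -> R[i].

Definition L2 (psi : edge_fun) :=
  forall j, square_integrable (edge_itv j) (psi j).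

Definition L2norm (psi : edge_fun) : R :=
  Num.sqrt (\sum_(j : edge Gr)
    \int[lebesgue_measure]_(x in edge_itv j) (Normc.normc (psi j x) ^+ 2)).

(* [psi] belongs to H^2(G), with first and second weak derivatives [psi1] and
   [psi2].  As the traces at the endpoints require, [psi] and [psi1] are the
   representatives that are continuous up to the boundary, which exist and are
   unique by the one-dimensional Sobolev embedding; [psi2] is any
   representative of the second derivative. *)
Definition H2 (psi psi1 psi2 : edge_fun) :=
  [/\ L2 psi, L2 psi1, L2 psi2,
      forall j, weak_derivative (edge_int j) (psi j) (psi1 j) /\
                weak_derivative (edge_int j) (psi1 j) (psi2 j) &
      forall j, continuous_on (edge_itv j) (psi j) /\
                continuous_on (edge_itv j) (psi1 j)].

Definition bdim : nat := (#|external Gr| + (#|internal Gr| + #|internal Gr|))%N.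

Definition trace (psi : edge_fun) : 'cV[R[i]]_bdim :=
  col_mx (\col_k psi (inl (enum_val k)) 0)
    (col_mx (\col_k psi (inr (enum_val k)) 0)
            (\col_k psi (inr (enum_val k)) (edge_length (enum_val k)))).

Definition trace' (psi1 : edge_fun) : 'cV[R[i]]_bdim :=
  col_mx (\col_k psi1 (inl (enum_val k)) 0)
    (col_mx (\col_k psi1 (inr (enum_val k)) 0)
            (\col_k (- psi1 (inr (enum_val k)) (edge_length (enum_val k))))).

(* Unbounded operators in L^2(G) are given by their graphs. *)
Definition operator := set (edge_fun * edge_fun).

Definition Delta (A B : 'M[R[i]]_bdim) : operator :=
  [set p | exists2 psi1, H2 p.1 psi1 p.2 &
                         A *m trace p.1 + B *m trace' psi1 = 0].

(* The graph of - T + z. *)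
Definition opp_shift (T : operator) (z : R[i]) : operator :=
  [set p | exists2 g, T (p.1, g) & p.2 = fun j x => - g j x + z * p.1 j x].

(* Inverse as a linear relation: if -z is in the resolvent set of -T, then
   [inverse (opp_shift T z)] is the graph of the everywhere defined bounded
   operator (-T + z)^-1. *)
Definition inverse (T : operator) : operator := [set p | T (p.2, p.1)].

(* The value is +oo for an unbounded operator or a multivalued relation. *)
Definition opnorm (T : operator) : \bar R :=
  ereal_sup [set (L2norm p.2)%:E | p in [set p | T p /\ L2norm p.1 <= 1]].

End Laplacian.

Section BoundaryConditions.
Variables (F : fieldType) (d : nat).
Implicit Types A B : 'M[F]_d.

Definition regular A B :=
  \rank (row_mx A B) = d /\ exists l : F, \det (A + l *: B) != 0.

Definition nilpotent n (N : 'M[F]_n) := exists k : nat, N ^+ k = 0.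

Definition quasi_weierstrass A B m (le_md : (m <= d)%N)
    (P Q : 'M[F]_d) (L : 'M[F]_m) (N : 'M[F]_(d - m)) :=
  let e := (subnKC le_md, subnKC le_md) in
  [/\ P \in unitmx, Q \in unitmx, nilpotent N,
      A = P *m castmx e (block_mx L 0 0 1%:M) *m Q &
      B = P *m castmx e (block_mx 1%:M 0 0 N) *m Q].

(* Since N is determined up to similarity by A and B, it does not matter which
   normal form is considered. *)
Definition quasi_sectorial A B :=
  regular A B /\
  exists m (le_md : (m <= d)%N) P Q L,
    quasi_weierstrass A B le_md P Q L (0 : 'M[F]_(d - m)).

End BoundaryConditions.

(* Main.v *)
Require Import Defs.
From mathcomp Require Import all_boot all_order all_algebra.
From mathcomp Require Import all_classical all_reals all_analysis.
From mathcomp Require Import measurable_realfun.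
From mathcomp Require Import complex.
From mathcomp Require Import ring lra.
Import Order.TTheory GRing.Theory Num.Theory.
Import numFieldNormedType.Exports.
Local Open Scope classical_set_scope.
Local Open Scope ring_scope.
Local Open Scope complex_scope.

(** Boundary conditions that are regular but not quasi-sectorial have a Jordan
    chain of length two at infinity ([exists_chain_at_infinity]): vectors [s]
    and [b] with [s] nonzero, [B s = 0] and [A s = B b].  Indeed, if
    [A + l B] is invertible and [M = (A + l B)^-1 B], the absence of such a
    chain means that kernel and image of [M] are complementary, and a basis
    adapted to them yields a normal form with [N = 0]
    ([quasi_sectorial_of_rank_sqr]).

    Such a chain gives an explicit function [psi] in the domain of the operator
    for which [phi = - psi'' + k^2 psi] is small.  Near the end of an edge, with
    [x] the distance to that end, [psi] is essentially
    [(s_n - b_n x) exp (- k x)], where [n] is the boundary coordinate of that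
    end.  The vectors of traces of [psi] and of its inward derivatives are [s]
    and [- b - k s], so that the boundary condition reads
    [A s - B b - k B s = 0] and holds for every [k] ([quasimode_Delta]).  The
    boundary layers at the two ends of an internal edge are made independent of
    each other by replacing the affine factor by a cubic polynomial with a
    double zero at the opposite end ([hermite]).

    Since [exp (- k x)] solves the homogeneous equation, [phi] is of size [k]
    on boundary strips of width [1 / k], and its norm is [O(k^(1/2))]
    ([source_upper]).  The function [psi] has size at least a constant on one
    such strip, because [s] is nonzero, and its norm is at least a constant
    times [k^(-1/2)] ([quasimode_lower]).  The quotient of the two norms is at
    least a constant times [1 / k]. *)

Set Implicit Arguments.
Unset Strict Implicit.
Unset Printing Implicit Defensive.

(** * Chains at infinity of a matrix pencil *)

Section SquareCast.
Variables (F : fieldType) (n d : nat) (e : n = d).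
Implicit Types X Y : 'M[F]_n.

Lemma castmx_mulmx X k (Y : 'M[F]_(n, k)) :
  castmx (e, e) X *m castmx (e, erefl k) Y = castmx (e, erefl k) (X *m Y).
Proof. by case: _ / e; rewrite !castmx_id. Qed.

Lemma castmx_rows_mulmx k p (Y : 'M[F]_(n, k)) (Z : 'M[F]_(k, p)) :
  castmx (e, erefl k) Y *m Z = castmx (e, erefl p) (Y *m Z).
Proof. by case: _ / e; rewrite !castmx_id. Qed.

Lemma castmx_mulmx2 X Y :
  castmx (e, e) X *m castmx (e, e) Y = castmx (e, e) (X *m Y).
Proof. by case: _ / e; rewrite !castmx_id. Qed.

Lemma castmx_1subZ l X :
  castmx (e, e) (1%:M - l *: X) = 1%:M - l *: castmx (e, e) X.
Proof. by case: _ / e; rewrite !castmx_id. Qed.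

Lemma castmx_unit X : (castmx (e, e) X \in unitmx) = (X \in unitmx).
Proof. by case: _ / e; rewrite !castmx_id. Qed.

End SquareCast.

Section FittingDecomposition.
Variables (F : fieldType) (d : nat).
Implicit Types (A B M : 'M[F]_d).

(** The inclusion says that [M] and [M *m M] have the same rank, hence the same
    kernel, so that [M] kills no nonzero vector of its own image. *)
Lemma capmx_ker_eq0 M : (M <= M *m M)%MS -> (M :&: kermx M)%MS = 0.
Proof.
move=> sMM2.
have rkM2 : \rank (M *m M) = \rank M.
  by apply/eqP; rewrite eqn_leq mxrankM_maxr mxrankS.
apply/eqP; rewrite -submx0; apply/rV_subP => u.
rewrite sub_capmx => /andP[/submxP[v ->] /sub_kermxP vMM].
have sK : (kermx (M *m M) <= kermx M)%MS.
  have sK' : (kermx M <= kermx (M *m M))%MS.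
    by apply/sub_kermxP; rewrite mulmxA mulmx_ker mul0mx.
  by rewrite -(geq_leqif (mxrank_leqif_sup sK')) !mxrank_ker rkM2.
have vK : (v <= kermx (M *m M))%MS by apply/sub_kermxP; rewrite mulmxA.
by rewrite (sub_kermxP (submx_trans vK sK)) sub0mx.
Qed.

(** Fitting's lemma for a matrix of index at most one: image and kernel are
    complementary invariant subspaces, and [M] is invertible on its image.
    The rows of [Q] are a basis of the image followed by one of the kernel. *)
Lemma fitting_index1 M : (M <= M *m M)%MS ->
  exists2 Q : 'M[F]_(\rank M + (d - \rank M), d), row_free Q &
    exists2 M1 : 'M[F]_(\rank M), M1 \in unitmx &
      Q *m M = block_mx M1 0 0 0 *m Q.
Proof.
move=> sMM2; have cap0 := capmx_ker_eq0 sMM2.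
pose R := row_base M.
pose K := castmx (mxrank_ker M, erefl d) (row_base (kermx M)).
have eqK : (K :=: kermx M)%MS.
  by apply: eqmx_trans (eqmx_cast _ _) (eq_row_base _).
have K0 : K *m M = 0 by apply/sub_kermxP; rewrite eqK.
have sRM : (R *m M <= R)%MS by rewrite /R eq_row_base submxMl.
have /submxP[M1 defM1] := sRM.
have capRK : (R :&: K)%MS = 0.
  by apply/eqP; rewrite -submx0 (cap_eqmx (eq_row_base M) eqK) cap0.
exists (col_mx R K).
  rewrite /row_free -addsmxE (mxrank_disjoint_sum capRK).
  by rewrite (eq_row_base M) eqK mxrank_ker.
exists M1; last first.
  by rewrite mul_col_mx K0 mul_block_col !mul0mx !addr0 defM1.
rewrite -row_free_unit -kermx_eq0; apply/eqP/row_matrixP => i.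
rewrite row0; set u := row i _.
have uM1 : u *m M1 = 0 by apply/sub_kermxP; rewrite row_sub.
have : (u *m R <= R :&: K)%MS.
  rewrite sub_capmx submxMl eqK; apply/sub_kermxP.
  by rewrite -mulmxA defM1 mulmxA uM1 mul0mx.
rewrite capRK submx0 => /eqP uR0.
by apply: (row_free_inj (row_base_free M)); rewrite uR0 mul0mx.
Qed.

(** With [P0 = A + l B] invertible and [M = P0^-1 B] one has [B = P0 M] and
    [A = P0 (1 - l M)], so that any decomposition [M ~ diag (M1, 0)] with [M1]
    invertible turns into a normal form of the pair by pulling the invertible
    factor [diag (M1, 1)] out to the left; then [L = M1^-1 - l] and [N = 0]. *)
Lemma quasi_sectorial_of_rank_sqr A B (l : F) :
    regular A B -> A + l *: B \in unitmx ->
    let M := invmx (A + l *: B) *m B in (M <= M *m M)%MS ->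
  quasi_sectorial A B.
Proof.
move=> regAB unitP M sMM2; split=> //.
have [Q0 freeQ0 [M1 unitM1 QM]] := fitting_index1 sMM2.
have le_rd : (\rank M <= d)%N by apply: rank_leq_row.
move: (\rank M) le_rd Q0 freeQ0 M1 unitM1 QM => m le_md Q0 freeQ0 M1 unitM1 QM.
exists m, le_md.
pose e := (subnKC le_md, subnKC le_md).
pose Q := castmx (subnKC le_md, erefl d) Q0.
have unitQ : Q \in unitmx by rewrite -row_free_unit /Q row_free_castmx.
pose D := block_mx M1 0 0 (1%:M : 'M[F]_(d - m)).
have unitD : castmx e D \in unitmx.
  by rewrite castmx_unit unitmxE det_ublock det1 mulr1 -unitmxE.
have QM' : Q *m M = castmx e (block_mx M1 0 0 0) *m Q.
  by rewrite /Q /e castmx_mulmx castmx_rows_mulmx QM.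
pose P0 := A + l *: B.
have defB : B = P0 *m M by rewrite mulKVmx.
have defM : M = invmx Q *m castmx e (block_mx M1 0 0 0) *m Q.
  by rewrite -mulmxA -QM' mulKmx.
exists (P0 *m invmx Q *m castmx e D), Q, (invmx M1 - l%:M).
have castDB (X Y : 'M[F]_m) Z : M1 *m X = Y ->
   castmx e D *m castmx e (block_mx X 0 0 Z) = castmx e (block_mx Y 0 0 Z).
  move=> XY; rewrite castmx_mulmx2 mulmx_block.
  by rewrite !mulmx0 !mul0mx !addr0 !add0r mul1mx XY.
split=> //; first by rewrite !unitmx_mul unitP unitmx_inv unitQ unitD.
- by exists 1%N; rewrite expr1.
- rewrite -[P0 *m _ *m _ *m _]mulmxA (castDB _ (1%:M - l *: M1)); last first.
    by rewrite mulmxBr mulmxV // mul_mx_scalar.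
  have -> : A = P0 *m (1%:M - l *: M).
    by rewrite mulmxBr mulmx1 -scalemxAr -defB addrK.
  have -> : block_mx (1%:M - l *: M1) 0 0 1%:M =
      1%:M - l *: block_mx M1 0 0 (0 : 'M[F]_(d - m)).
    rewrite scale_block_mx !scaler0 (scalar_mx_block m (d - m)) opp_block_mx.
       by rewrite add_block_mx !oppr0 !addr0.
  rewrite -!mulmxA; congr (_ *m _); rewrite {1}defM.
  have -> : castmx e (1%:M - l *: block_mx M1 0 0 0) =
      1%:M - l *: castmx e (block_mx M1 0 0 (0 : 'M[F]_(d - m))).
    exact: castmx_1subZ.
  rewrite mulmxBl mulmxBr mul1mx mulVmx //; congr (_ - _).
  by rewrite -scalemxAl -scalemxAr mulmxA.
- rewrite -[P0 *m _ *m _ *m _]mulmxA (castDB _ M1) ?mulmx1 //.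
  by rewrite {1}defB {1}defM !mulmxA.
Qed.

(** The failure of quasi-sectoriality is a Jordan chain of length two of the
    pencil at infinity, namely a nonzero [s] in the kernel of [B] whose image
    under [A] lies in the image of [B].  It comes from a vector killed by
    [M *m M] but not by [M], where [M = (A + l B)^-1 B]. *)
Lemma exists_chain_at_infinity A B : regular A B -> ~ quasi_sectorial A B ->
  exists s b : 'cV[F]_d, exists k : 'I_d,
    [/\ A *m s = B *m b, B *m s = 0 & s k 0 = 1].
Proof.
move=> regAB nqsAB; have [_ [l detP]] := regAB.
have unitP : A + l *: B \in unitmx by rewrite unitmxE unitfE.
pose M := invmx (A + l *: B) *m B.
have defB : B = (A + l *: B) *m M by rewrite mulKVmx.
case: (boolP (M <= M *m M)%MS) => [sMM2|].
  by case: nqsAB; exact: (quasi_sectorial_of_rank_sqr regAB unitP sMM2).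
pose C := cokermx (M *m M); rewrite submxE -/C.
move=> /matrix0Pn[k [j nzMC]]; set c := _ k j in nzMC.
exists (c^-1 *: (M *m col j C)), (c^-1 *: col j C), k.
have Bs : B *m (M *m col j C) = 0.
  rewrite defB -mulmxA (mulmxA M M) colE [_ *m (C *m _)]mulmxA mulmx_coker.
  by rewrite mul0mx mulmx0.
split.
- rewrite -!scalemxAr; congr (_ *: _).
  have -> : A = (A + l *: B) - l *: B by rewrite addrK.
  by rewrite mulmxBl -scalemxAl Bs scaler0 subr0 mulmxA -defB.
- by rewrite -scalemxAr Bs scaler0.
- by rewrite mxE colE mulmxA -colE mxE mulVf.
Qed.

End FittingDecomposition.

(** * Weak derivatives of smooth functions *)

Section Smooth.
Variable R : realType.
Implicit Types (u v f : R -> R).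

Lemma is_derive_continuous u v : (forall x, is_derive x (1 : R) u (v x)) ->
  continuous u.
Proof.
move=> du x; apply: differentiable_continuous; apply/derivable1_diffP.
exact: ex_derive.
Qed.

(** Integrals of functions supported in [K] may be moved to any other domain
    that contains [K]; this frees the integration by parts below from the shape
    of the domain. *)
Lemma Rintegral_support (D E K : set R) f : K `<=` D -> K `<=` E ->
    (forall x, ~ K x -> f x = 0) ->
  \int[lebesgue_measure]_(x in D) f x = \int[lebesgue_measure]_(x in E) f x.
Proof.
move=> KD KE f0; rewrite Rintegral_mkcond [RHS]Rintegral_mkcond.
congr (Rintegral _ _ _); apply/funext => x; rewrite /patch.
case: (pselect (K x)) => [Kx|/f0 ->]; last by rewrite !if_same.
by rewrite !mem_set //; [exact: KE|exact: KD].
Qed.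

Lemma derive1_eq0_off_closed K f : closed K -> (forall x, ~ K x -> f x = 0) ->
  forall x, ~ K x -> derive1 f x = 0.
Proof.
move=> cK f0 x Kx; rewrite derive1E.
have /near_eq_derive -> : \near x, f x = cst 0 x.
  near=> y; apply: f0; near: y.
  by apply: open_nbhs_nbhs; split => //; exact: closed_openC.
  by rewrite derive_cst.
Unshelve. all: by end_near. Qed.

Lemma weak_derivative_of_C1 (D : set R) u v :
    (forall x, is_derive x (1 : R) u (v x)) -> continuous v ->
  weak_derivative_real D u v.
Proof.
move=> du cv phi [smooth_phi [K [cK KD] phi0]].
have dphi x : derivable phi x 1 by have := smooth_phi 0%N x.
have cphi : continuous phi.
  by move=> x; apply: differentiable_continuous; exact/derivable1_diffP.
have cdphi : continuous (derive1 phi).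
  move=> x; apply: differentiable_continuous; apply/derivable1_diffP.
  exact: (smooth_phi 1%N x).
have dphi0 : forall x, ~ K x -> (derive1 phi) x = 0.
  apply: derive1_eq0_off_closed phi0; apply: compact_closed cK.
  exact: Rhausdorff.
(* The compact support fits strictly inside a large bounded interval, at the
   ends of which the test function vanishes. *)
have [M [Mreal KM]] := compact_bounded cK.
pose T : R := `|M| + 1.
have T_gt0 : 0 < T by rewrite /T ltr_wpDl.
have KT x : K x -> `|x| < T + 1.
  move=> Kx; rewrite (le_lt_trans (KM T _ x Kx)) ?ltrDl //.
  by rewrite /T (le_lt_trans (ler_norm M)) ?ltrDl.
pose E : set R := `[- (T + 1), T + 1]%classic.
have KE : K `<=` E.
  by move=> x /KT; rewrite ltr_norml /E /= in_itv /= => /andP[/ltW -> /ltW ->].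
rewrite (@Rintegral_support D E K) //; last first.
  by move=> x /dphi0 ->; rewrite mulr0.
rewrite (@Rintegral_support D E K (fun x => v x * phi x)) //; last first.
  by move=> x /phi0 ->; rewrite mulr0.
have cu := is_derive_continuous du.
rewrite (@Rintegration_by_parts R u phi v (derive1 phi)).
- rewrite !phi0 ?mulr0 ?subr0 ?sub0r //; move=> /KT;
    rewrite ?normrN gtr0_norm ?ltxx //; lra.
- lra.
- exact: continuous_subspaceT.
- split=> [x _||]; first exact: ex_derive.
  + exact/cvg_at_right_filter/cu.
  + exact/cvg_at_left_filter/cu.
- by move=> x _; rewrite derive1E; exact: derive_val.
- exact: continuous_subspaceT.
- split=> [x _||]; first exact: dphi.
  + exact/cvg_at_right_filter/cphi.
  + exact/cvg_at_left_filter/cphi.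
- by [].
Qed.

End Smooth.

(** * Exponential boundary layers *)

Section Layers.
Variable R : realType.
Implicit Types (p r : {poly R}) (k l x : R).

Definition layer k p x := p.[x] * expR (- (k * x)).

(** A boundary layer at each end of an edge of length [l].  On an external edge
    [r] is zero and [l] is irrelevant, so that one family of functions serves
    all edges. *)
Definition two_layers k l p r x := layer k p x + layer k r (l - x).

(** [layer k (layer_deriv k p)] is the derivative of [layer k p]. *)
Definition layer_deriv k p := p^`() - k *: p.

Lemma is_derive_layer k p x :
  is_derive x (1 : R) (layer k p) (layer k (layer_deriv k p) x).
Proof.
have dexp : is_derive x (1 : R) (expR \o (fun y => - (k * y)))
    (expR (- (k * x)) * - k).
  apply: is_derive1_comp.
  have -> : (fun y => - (k * y)) = horner ((- k) *: 'X).
    by apply/funext => y; rewrite !hornerE mulNr.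
  have := is_derive_poly ((- k) *: 'X) x.
  by rewrite derivZ derivX !hornerE.
have -> : layer k p = horner p * (expR \o (fun y => - (k * y))) by [].
have := is_deriveM (is_derive_poly p x) dexp.
move=> /is_derive_eq; apply.
by rewrite /layer /layer_deriv !hornerE /GRing.scale /=; ring.
Qed.

Lemma is_derive_two_layers k l p r x :
  is_derive x (1 : R) (two_layers k l p r)
    (two_layers k l (layer_deriv k p) (- layer_deriv k r) x).
Proof.
have drefl : is_derive x (1 : R) (layer k r \o (fun y => l - y))
    (layer k (layer_deriv k r) (l - x) * -1).
  apply: is_derive1_comp; first exact: is_derive_layer.
  have -> : (fun y => l - y) = horner (l%:P - 'X).
    by apply/funext => y; rewrite !hornerE.
  have := is_derive_poly (l%:P - 'X) x.
  by rewrite derivB derivC derivX sub0r !hornerE.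
have := is_deriveD (is_derive_layer k p x) drefl.
move=> /is_derive_eq; apply.
by rewrite /two_layers /layer hornerN mulrN1 mulNr.
Qed.

Lemma continuous_two_layers k l p r : continuous (two_layers k l p r).
Proof. exact: is_derive_continuous (is_derive_two_layers k l p r). Qed.

Lemma two_layersC k l p r x : two_layers k l p r x = two_layers k l r p (l - x).
Proof. by rewrite /two_layers subKr addrC. Qed.

Lemma two_layersZ k l t p r x :
  two_layers k l (t *: p) (t *: r) x = t * two_layers k l p r x.
Proof. by rewrite /two_layers /layer !hornerZ; ring. Qed.

(** The exponentials solve the homogeneous equation, so the terms of order
    [k ^+ 2] cancel and the residual is only of order [k]. *)
Lemma two_layers_equation k l p r x :
  - two_layers k l (layer_deriv k (layer_deriv k p))
      (- layer_deriv k (- layer_deriv k r)) x + k ^+ 2 * two_layers k l p r x =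
  2 * k * two_layers k l p^`() r^`() x - two_layers k l p^`()^`() r^`()^`() x.
Proof.
rewrite /two_layers /layer /layer_deriv !(derivB, derivZ, derivN, hornerE).
by ring.
Qed.

Lemma le_expRM e x : 0 < e -> x <= e^-1 * expR (e * x).
Proof.
move=> e0; rewrite ler_pdivlMl //.
by apply: le_trans (expR_ge1Dx (e * x)); rewrite lerDr.
Qed.

Lemma poly_le_expR p e : 0 < e ->
  exists2 K, 0 <= K & forall x, 0 <= x -> `|p.[x]| <= K * expR (e * x).
Proof.
elim/poly_ind: p e => [|p c IH] e e0.
  by exists 0 => // x _; rewrite horner0 normr0 mul0r.
have e20 : 0 < e / 2 by rewrite divr_gt0.
have [K K0 pK] := IH _ e20.
exists (K * (e / 2)^-1 + `|c|) => [|x x0].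
  by rewrite addr_ge0 // mulr_ge0 // invr_ge0 ltW.
rewrite !hornerE (le_trans (ler_normD _ _)) // normrM mulrDl lerD //.
  have -> : expR (e * x) = expR (e / 2 * x) * expR (e / 2 * x).
    by rewrite -expRD; congr expR; field.
  rewrite mulrACA ler_pM //; first exact: pK.
  by rewrite ger0_norm // le_expRM.
by rewrite ler_peMr // -expR0 ler_expR mulr_ge0 // ltW.
Qed.

(** Half of the decay is spent on the polynomial factor, which makes the bound
    uniform in [k]. *)
Lemma layer_sqr_le p : exists2 K, 0 <= K &
  forall k x, 1 <= k -> 0 <= x -> layer k p x ^+ 2 <= K * expR (- (k * x)).
Proof.
have h0 : 0 < 2^-1 :> R by rewrite invr_gt0.
have [K K0 pK] := poly_le_expR p h0.
exists (K ^+ 2) => [|k x k1 x0]; first exact: sqr_ge0.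
rewrite -real_normK ?num_real // /layer normrM exprMn.
rewrite (ger0_norm (expR_ge0 _)).
apply: (@le_trans _ _ ((K * expR (2^-1 * x)) ^+ 2 * expR (- (k * x)) ^+ 2)).
  by rewrite ler_wpM2r ?sqr_ge0 // lerXn2r ?nnegrE ?mulr_ge0 ?expR_ge0 ?pK.
rewrite exprMn -mulrA ler_wpM2l ?sqr_ge0 // !expr2 -!expRD ler_expR.
have : x <= k * x by rewrite ler_peMl.
lra.
Qed.

(** On a boundary strip of width [k^-1] the exponential stays above [e^-1] and
    the polynomial stays within [O(k^-1)] of its boundary value. *)
Lemma layer_ge p : p.[0] = 1 -> exists2 k0, 0 < k0 &
  forall k x, k0 <= k -> 0 <= x <= k^-1 -> 3 / 4 * expR (-1) <= layer k p x.
Proof.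
move=> p01.
have /factor_theorem[q pq] : root (p - 1) 0 by rewrite /root !hornerE p01 subrr.
have [K K0 qK] := poly_le_expR q (@ltr01 R).
(* [4 K e] makes the deviation of [p] from [1] at most a quarter, and [1] puts
   the strip inside [0, 1]. *)
pose M := 4 * K * expR 1 + 1.
have M0 : 0 < M by rewrite ltr_wpDl // !mulr_ge0 // expR_ge0.
exists M => // k x Mk /andP[x0 xk].
have k0 : 0 < k by apply: lt_le_trans Mk.
have k1 : 1 <= k.
  by apply: le_trans Mk; rewrite lerDr !mulr_ge0 // expR_ge0.
have x1 : x <= 1 by rewrite (le_trans xk) // invf_le1.
have px : p.[x] = q.[x] * x + 1.
  by rewrite -[p](subrK 1) pq !hornerE subr0.
have qx : `|q.[x] * x| <= 1 / 4.
  rewrite normrM (ger0_norm x0).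
  apply: (@le_trans _ _ (K * expR 1 * k^-1)).
    rewrite ler_pM // (le_trans (qK _ x0)) // ler_wpM2l // ler_expR; lra.
  by rewrite ler_pdivrMr //; move: Mk; rewrite /M; lra.
have ex : expR (-1) <= expR (- (k * x)).
  by rewrite ler_expR lerN2 -(divff (lt0r_neq0 k0)) ler_pM2l.
rewrite /layer ler_pM ?expR_ge0 // px.
by move: qx; rewrite ler_norml => /andP[]; lra.
Qed.

(** The layer of the opposite end has decayed to [O((k l)^-1)] on that strip. *)
Lemma far_layer_le r l : 0 < l -> exists2 k0, 0 < k0 &
  forall k x, k0 <= k -> 0 <= x <= k^-1 ->
    `|layer k r (l - x)| <= 4^-1 * expR (-1).
Proof.
move=> l0; have [K K0 rK] := poly_le_expR r (@ltr01 R).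
(* [2] absorbs the polynomial, [2 / l] puts the strip in the half of the edge
   away from the layer, and the last term makes [4 K / (k l)] small enough. *)
pose M := 2 + 2 / l + 16 * K * expR 1 / l.
have M2 : 2 + 2 / l <= M.
  by rewrite lerDl !mulr_ge0 ?invr_ge0 ?expR_ge0 // ltW.
have l20 : 0 < 2 / l by rewrite divr_gt0.
exists M => [|k x Mk /andP[x0 xk]]; first lra.
have k2 : 2 <= k by lra.
have kl : 2 <= k * l by rewrite -ler_pdivrMr //; lra.
have xl : k * x <= 1.
  by rewrite mulrC -ler_pdivlMr ?div1r //; lra.
have k0 : 0 < k by lra.
have ylow : k * l / 2 <= k * (l - x) by rewrite mulrBr; lra.
have y0 : 0 <= l - x.
  by rewrite -(pmulr_rge0 _ k0); apply: le_trans ylow; lra.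
rewrite /layer normrM (ger0_norm (expR_ge0 _)).
apply: (@le_trans _ _ (K * expR (1 * (l - x)) * expR (- (k * (l - x))))).
  by rewrite ler_wpM2r ?expR_ge0 // rK.
rewrite -mulrA -expRD.
apply: (@le_trans _ _ (K * expR (- (k * l / 4)))).
  rewrite ler_wpM2l // ler_expR.
  have : 2 * (l - x) <= k * (l - x) by rewrite ler_wpM2r.
  lra.
have kl4 : 0 < k * l / 4 by lra.
have le4 : expR (- (k * l / 4)) <= (k * l / 4)^-1.
  rewrite expRN lef_pV2 ?posrE ?expR_gt0 //.
  by apply: le_trans (expR_ge1Dx _); rewrite lerDr.
apply: (le_trans (ler_wpM2l K0 le4)).
rewrite ler_pdivrMr // expRN.
have : 16 * K * expR 1 / l <= k by apply: le_trans Mk; rewrite /M lerDr; lra.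
rewrite ler_pdivrMr // => H.
rewrite [4^-1 * _ * _]mulrC mulrA ler_pdivlMr ?expR_gt0 //; lra.
Qed.

Lemma two_layers_ge p r l : p.[0] = 1 -> 0 < l \/ r = 0 ->
  exists2 k0, 0 < k0 & forall k x, k0 <= k -> 0 <= x <= k^-1 ->
    expR (-1) / 2 <= two_layers k l p r x.
Proof.
move=> p01 lr; have [k1 k10 Hp] := layer_ge p01.
have [k2 k20 Hr] : exists2 k0, 0 < k0 &
  forall k x, k0 <= k -> 0 <= x <= k^-1 ->
    `|layer k r (l - x)| <= 4^-1 * expR (-1).
  case: lr => [|->]; first exact: far_layer_le.
  exists 1 => // k x _ _; rewrite /layer horner0 mul0r normr0.
  by rewrite mulr_ge0 ?expR_ge0.
exists (Num.max k1 k2) => [|k x]; first by rewrite lt_max k10.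
rewrite ge_max => /andP[kk1 kk2] Hx.
have := Hp _ _ kk1 Hx; have := Hr _ _ kk2 Hx.
by rewrite ler_norml /two_layers => /andP[]; lra.
Qed.

End Layers.

(** * Square integrals of boundary layers on the edges *)

Section Edges.
Variables (R : realType) (Gr : metric_graph R).
Local Notation mu := (@lebesgue_measure R).
Implicit Types (k t : R) (j : edge Gr).

(** The length of an external edge is set to [0], because [0^-1 = 0] is then the
    right scale in [hermite] below. *)
Definition edge_len j : R := if j is inr i then edge_length i else 0.

(** Up to a constant, a majorant of the squares of all layered functions. *)
Definition decay k j : R -> R :=
  two_layers k (edge_len j) 1 (if j is inr _ then 1 else 0).

Lemma measurable_edge_itv j : measurable (edge_itv j).
Proof. by case: j => [e|i]; exact: measurable_itv. Qed.

Lemma edge_itv_ge0 j x : edge_itv j x -> 0 <= x.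
Proof. by case: j => [e|i]; rewrite /= in_itv /= => /andP[]. Qed.

Lemma layer_ge0 k p x : 0 <= p.[x] -> 0 <= layer k p x.
Proof. by move=> p0; rewrite mulr_ge0 ?expR_ge0. Qed.

Lemma layer1 k x : layer k 1 x = expR (- (k * x)).
Proof. by rewrite /layer hornerE mul1r. Qed.

Lemma decay_ge0 k j x : 0 <= decay k j x.
Proof.
rewrite addr_ge0 // layer_ge0 //; first by rewrite hornerE.
by case: j => ?; rewrite hornerE.
Qed.

Lemma integral_decay_external k : 0 < k ->
  (\int[mu]_(x in `[0%R, +oo[) (layer k 1 x)%:E = (k^-1)%:E)%E.
Proof.
move=> k0.
have dF x : is_derive x (1 : R) (layer k (- k^-1)%:P) (layer k 1 x).
  have := is_derive_layer k (- k^-1)%:P x.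
  move=> /is_derive_eq; apply; rewrite /layer /layer_deriv derivC !hornerE.
  by field; rewrite gt_eqF.
have cF := is_derive_continuous dF.
rewrite (@ge0_continuous_FTC2y _ _ (layer k (- k^-1)%:P) 0 0).
- by rewrite /layer hornerC mulr0 oppr0 expR0 mulr1 -EFinB sub0r opprK.
- by move=> x _; rewrite layer_ge0 ?hornerE.
- apply: continuous_subspaceT.
  exact: is_derive_continuous (is_derive_layer k 1).
- rewrite -(mulr0 (- k^-1)) /layer.
  under eq_fun do rewrite hornerE.
  apply: cvgM; first exact: cvg_cst.
  apply: (@cvg_comp _ _ _ (fun x => k * x) (fun z => expR (- z)) _
    (pinfty_nbhs R)).
    exact: gt0_cvgMry.
  exact: cvgr_expR.
- by move=> x _; exact: ex_derive.
- by apply: cvg_at_right_filter; exact: cF.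
- by move=> x _; rewrite derive1E; exact: derive_val.
Qed.

Lemma integral_decay_internal k l : 0 < k -> 0 < l ->
  (\int[mu]_(x in `[0%R, l]) (two_layers k l 1 1 x)%:E =
   (2 * (1 - expR (- (k * l))) / k)%:E)%E.
Proof.
move=> k0 l0.
(* The antiderivative lies in the same family. *)
pose F := two_layers k l (- k^-1)%:P (k^-1)%:P.
have dF x : is_derive x (1 : R) F (two_layers k l 1 1 x).
  have := is_derive_two_layers k l (- k^-1)%:P (k^-1)%:P x.
  move=> /is_derive_eq; apply.
  rewrite /two_layers /layer /layer_deriv !derivC !hornerE.
  by field; rewrite gt_eqF.
have cF := is_derive_continuous dF.
rewrite (@continuous_FTC2 _ _ F 0 l) //.
- rewrite /F /two_layers /layer !hornerE !subr0 subrr mulr0 oppr0 expR0 -EFinB.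
  by congr EFin; field; rewrite gt_eqF.
- apply: continuous_subspaceT; exact: continuous_two_layers.
- split=> [x _||]; first exact: ex_derive.
  + exact/cvg_at_right_filter/cF.
  + exact/cvg_at_left_filter/cF.
- by move=> x _; rewrite derive1E; exact: derive_val.
Qed.

Lemma integral_decay k j : 0 < k ->
  exists2 c, c <= 2 / k &
    (\int[mu]_(x in edge_itv j) (decay k j x)%:E = c%:E)%E.
Proof.
move=> k0; rewrite /decay; case: j => [e|i] /=.
  exists k^-1; first by rewrite ler_peMl ?invr_ge0 ?ltW // ltr1n.
  rewrite -integral_decay_external //; apply: eq_integral => x _.
  by rewrite /two_layers /layer horner0 mul0r addr0.
have l0 := edge_length_gt0 i.
exists (2 * (1 - expR (- (k * edge_length i))) / k).
  rewrite ler_wpM2r ?invr_ge0 ?(ltW k0) //.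
  by rewrite ler_piMr // lerBlDr lerDl expR_ge0.
exact: integral_decay_internal.
Qed.

Lemma integrable_decay k j : 0 < k ->
  mu.-integrable (edge_itv j) (EFin \o decay k j).
Proof.
move=> k0; have [c _ intE] := integral_decay j k0.
apply/integrableP; split.
  apply/measurable_EFinP; apply: measurable_funTS.
  by apply: continuous_measurable_fun; exact: continuous_two_layers.
under eq_integral => x _ do rewrite /= ger0_norm ?decay_ge0 //.
by rewrite intE ltry.
Qed.

Lemma integrable_le_decay k j (f : R -> R) K : 0 < k -> continuous f ->
    (forall x, edge_itv j x -> 0 <= f x <= K * decay k j x) ->
  mu.-integrable (edge_itv j) (EFin \o f).
Proof.
move=> k0 cf fK.
apply: (@le_integrable _ _ _ mu _ _ _ (EFin \o (fun x => K * decay k j x))).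
- exact: measurable_edge_itv.
- apply/measurable_EFinP; apply: measurable_funTS.
  by apply: continuous_measurable_fun; exact: cf.
- move=> x Dx /=; have /andP[f0 fx] := fK _ Dx.
  by rewrite lee_fin !ger0_norm // (le_trans f0).
- have -> : EFin \o (fun x => K * decay k j x) =
      (fun x => K%:E * (EFin \o decay k j) x)%E by [].
  apply: integrableZl; first exact: measurable_edge_itv.
  exact: integrable_decay.
Qed.

Lemma Rintegral_le_decay k j (f : R -> R) K : 0 < k -> 0 <= K -> continuous f ->
    (forall x, edge_itv j x -> 0 <= f x <= K * decay k j x) ->
  \int[mu]_(x in edge_itv j) f x <= K * (2 / k).
Proof.
move=> k0 K0 cf fK; have mD := measurable_edge_itv j.
have intd := integrable_decay j k0.
have [c c2 intE] := integral_decay j k0.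
apply: (@le_trans _ _ (\int[mu]_(x in edge_itv j) (K * decay k j x))).
  apply: le_Rintegral => //; first exact: integrable_le_decay fK.
    have -> : EFin \o (fun x => K * decay k j x) =
      (fun x => K%:E * (EFin \o decay k j) x)%E by [].
    exact: integrableZl.
  by move=> x /fK/andP[].
by rewrite RintegralZl // /Rintegral intE ler_wpM2l.
Qed.

(** External edges carry no second layer: it would grow at infinity. *)
Definition far_free j (r : {poly R}) := if j is inl _ then r = 0 else True.

Lemma two_layers_sqr_le j p r : far_free j r -> exists2 K, 0 <= K &
  forall k x, 1 <= k -> edge_itv j x ->
    two_layers k (edge_len j) p r x ^+ 2 <= K * decay k j x.
Proof.
have sqrD (a b : R) : (a + b) ^+ 2 <= 2 * a ^+ 2 + 2 * b ^+ 2.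
  by rewrite -subr_ge0 (_ : _ - _ = (a - b) ^+ 2) ?sqr_ge0 //; ring.
move=> jr; have [Kp Kp0 Hp] := layer_sqr_le p.
have [Kr Kr0 Hr] := layer_sqr_le r.
exists (2 * Kp + 2 * Kr) => [|k x k1 Dx]; first lra.
have x0 := edge_itv_ge0 Dx.
apply: (le_trans (sqrD _ _)); rewrite /decay /two_layers mulrDr.
have Hnear : 2 * layer k p x ^+ 2 <= (2 * Kp + 2 * Kr) * layer k 1 x.
  rewrite layer1.
  have := Hp _ _ k1 x0.
  have : 0 <= Kr * expR (- (k * x)) by rewrite mulr_ge0 ?expR_ge0.
  by lra.
rewrite lerD // {Hnear}.
case: j jr Dx => [e ->|i _] Dx /=.
  by rewrite /layer !horner0 !mul0r expr0n /= !mulr0.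
rewrite layer1.
have y0 : 0 <= edge_length i - x.
  by move: Dx; rewrite /= in_itv /= subr_ge0 => /andP[].
have := Hr _ _ k1 y0.
have : 0 <= Kp * expR (- (k * (edge_length i - x))).
  by rewrite mulr_ge0 ?expR_ge0.
by lra.
Qed.

End Edges.

(** * Layered functions on the graph *)

Section LayeredFunctions.
Variables (R : realType) (Gr : metric_graph R).
Implicit Types (k t : R) (j : edge Gr).

(** The polynomial factors of the layers at the two ends of each edge. *)
Definition profile := edge Gr -> {poly R} * {poly R}.
Implicit Types (P Q : profile).

Definition edge_layers k P j : R -> R :=
  two_layers k (edge_len j) (P j).1 (P j).2.

Definition layered k P Q : edge_fun Gr :=
  fun j x => (edge_layers k P j x +i* edge_layers k Q j x)%C.

Definition profile_deriv k P : profile :=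
  fun j => (layer_deriv k (P j).1, - layer_deriv k (P j).2).

Definition admissible P := forall j, far_free j (P j).2.

Lemma admissible_deriv k P : admissible P -> admissible (profile_deriv k P).
Proof.
move=> aP j; move: (aP j); rewrite /far_free; case: j => // e /= ->.
by rewrite /layer_deriv deriv0 scaler0 subr0 oppr0.
Qed.

Lemma horner_layer_deriv k p x :
  (layer_deriv k p).[x] = p^`().[x] - k * p.[x].
Proof. by rewrite /layer_deriv !hornerE. Qed.

Lemma normc_sqr (a b : R) : Normc.normc (a +i* b)%C ^+ 2 = a ^+ 2 + b ^+ 2.
Proof. by rewrite /= sqr_sqrtr // addr_ge0 ?sqr_ge0. Qed.

Lemma continuous_sqrD (f g : R -> R) : continuous f -> continuous g ->
  continuous (fun x => f x ^+ 2 + g x ^+ 2).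
Proof.
move=> cf cg x; apply: cvgD; rewrite expr2.
  by apply: cvgM; exact: cf.
by apply: cvgM; exact: cg.
Qed.

Lemma layered_sqr_le P Q j : admissible P -> admissible Q ->
  exists2 K, 0 <= K & forall k x, 1 <= k -> edge_itv j x ->
    0 <= edge_layers k P j x ^+ 2 + edge_layers k Q j x ^+ 2 <= K * decay k j x.
Proof.
move=> /(_ j) aP /(_ j) aQ.
have [KP KP0 HP] := two_layers_sqr_le (P j).1 aP.
have [KQ KQ0 HQ] := two_layers_sqr_le (Q j).1 aQ.
exists (KP + KQ) => [|k x k1 Dx]; first exact: addr_ge0.
by rewrite addr_ge0 ?sqr_ge0 // mulrDl lerD ?HP ?HQ.
Qed.

Lemma layered_L2 k P Q : 1 <= k -> admissible P -> admissible Q ->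
  L2 (layered k P Q).
Proof.
move=> k1 aP aQ j.
have cP : continuous (edge_layers k P j) by exact: continuous_two_layers.
have cQ : continuous (edge_layers k Q j) by exact: continuous_two_layers.
have [K K0 HK] := layered_sqr_le j aP aQ.
have k0 : 0 < k by exact: lt_le_trans k1.
split.
- by apply: measurable_funTS; apply: continuous_measurable_fun; exact: cP.
- by apply: measurable_funTS; apply: continuous_measurable_fun; exact: cQ.
- under eq_fun do rewrite normc_sqr.
  apply: (integrable_le_decay k0 (continuous_sqrD cP cQ)) => x Dx.
  exact: HK.
Qed.

Lemma is_derive_edge_layers k P j x :
  is_derive x (1 : R) (edge_layers k P j)
    (edge_layers k (profile_deriv k P) j x).
Proof. exact: is_derive_two_layers. Qed.

Lemma weak_derivative_layered k P Q (D : set R) j :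
  weak_derivative D (layered k P Q j)
    (layered k (profile_deriv k P) (profile_deriv k Q) j).
Proof.
split.
- exact: weak_derivative_of_C1 (is_derive_edge_layers k P j)
    (@continuous_two_layers _ _ _ _ _).
- exact: weak_derivative_of_C1 (is_derive_edge_layers k Q j)
    (@continuous_two_layers _ _ _ _ _).
Qed.

Lemma layered_continuous_on k P Q (D : set R) j :
  continuous_on D (layered k P Q j).
Proof.
by split; apply: continuous_subspaceT; exact: continuous_two_layers.
Qed.

Lemma layered_H2 k P Q : 1 <= k -> admissible P -> admissible Q ->
  let P1 := profile_deriv k P in let Q1 := profile_deriv k Q in
  H2 (layered k P Q) (layered k P1 Q1)
     (layered k (profile_deriv k P1) (profile_deriv k Q1)).
Proof.
move=> k1 aP aQ P1 Q1.
have aP1 : admissible P1 by exact: admissible_deriv.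
have aQ1 : admissible Q1 by exact: admissible_deriv.
split; try by apply: layered_L2; do ?exact: admissible_deriv.
- by move=> j; split; exact: weak_derivative_layered.
- by move=> j; split; exact: layered_continuous_on.
Qed.

(** The cubic with value [a] and slope [- b] at [0] and a double zero at [c^-1].
    For [c = 0] it is the affine function [a - b X], which suits external
    edges.  The double zero decouples the two ends of an internal edge, so that
    boundary conditions hold exactly and not only up to exponentially small
    errors. *)
Definition hermite (c a b : R) : {poly R} :=
  a *: ((1 - c *: 'X) ^+ 2 * (1 + 2 * c *: 'X))
  - b *: ('X * (1 - c *: 'X) ^+ 2).

Lemma horner_hermite c a b x : (hermite c a b).[x] =
  a * ((1 - c * x) ^+ 2 * (1 + 2 * c * x)) - b * (x * (1 - c * x) ^+ 2).
Proof. by rewrite /hermite !expr2 !hornerE /=; ring. Qed.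

Lemma horner_deriv_hermite c a b x : (hermite c a b)^`().[x] =
  a * (- (6 * c ^+ 2 * x) * (1 - c * x)) - b * ((1 - c * x) * (1 - 3 * c * x)).
Proof. by rewrite /hermite !expr2 !poly.derivE !hornerE /=; ring. Qed.

Lemma hermite0 c a b : (hermite c a b).[0] = a.
Proof. by rewrite horner_hermite; ring. Qed.

Lemma hermite_deriv0 c a b : (hermite c a b)^`().[0] = - b.
Proof. by rewrite horner_deriv_hermite; ring. Qed.

Lemma hermite_end l a b : l != 0 -> (hermite l^-1 a b).[l] = 0.
Proof. by move=> l0; rewrite horner_hermite mulVf //; ring. Qed.

Lemma hermite_deriv_end l a b : l != 0 -> (hermite l^-1 a b)^`().[l] = 0.
Proof. by move=> l0; rewrite horner_deriv_hermite mulVf //; ring. Qed.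

Lemma hermiteZ c t a b : hermite c (t * a) (t * b) = t *: hermite c a b.
Proof. by rewrite /hermite scalerBr !scalerA. Qed.

Definition near_coord j : 'I_(bdim Gr) :=
  match j with
  | inl e => lshift _ (enum_rank e)
  | inr i => rshift _ (lshift _ (enum_rank i))
  end.

Definition far_coord i : 'I_(bdim Gr) := rshift _ (rshift _ (enum_rank i)).

Lemma coordP (n : 'I_(bdim Gr)) :
  (exists j, n = near_coord j) \/ (exists i, n = far_coord i).
Proof.
case: (fintype.split_ordP n) => [e ->|m ->].
  by left; exists (inl (enum_val e)); rewrite /= enum_valK.
case: (fintype.split_ordP m) => [i ->|i ->].
  by left; exists (inr (enum_val i)); rewrite /= enum_valK.
by right; exists (enum_val i); rewrite /far_coord enum_valK.
Qed.

Lemma eq_boundary_col (f : external Gr -> R[i]) (g h : internal Gr -> R[i])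
    (v : 'cV[R[i]]_(bdim Gr)) :
    (forall e, f e = v (near_coord (inl e)) 0) ->
    (forall i, g i = v (near_coord (inr i)) 0) ->
    (forall i, h i = v (far_coord i) 0) ->
  col_mx (\col_k f (enum_val k))
    (col_mx (\col_k g (enum_val k)) (\col_k h (enum_val k))) = v.
Proof.
move=> fv gv hv; apply/colP => n.
case: (fintype.split_ordP n) => [e ->|m ->].
  by rewrite col_mxEu mxE fv /= enum_valK.
rewrite col_mxEd; case: (fintype.split_ordP m) => [i ->|i ->].
  by rewrite col_mxEu mxE gv /= enum_valK.
by rewrite col_mxEd mxE hv /far_coord enum_valK.
Qed.

Lemma eq_trace (psi : edge_fun Gr) (v : 'cV[R[i]]_(bdim Gr)) :
    (forall j, psi j 0 = v (near_coord j) 0) ->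
    (forall i, psi (inr i) (edge_length i) = v (far_coord i) 0) ->
  trace psi = v.
Proof.
move=> near_v far_v.
by apply: (@eq_boundary_col (fun e => psi (inl e) 0) (fun i => psi (inr i) 0)
  (fun i => psi (inr i) (edge_length i))).
Qed.

Lemma eq_trace' (psi : edge_fun Gr) (v : 'cV[R[i]]_(bdim Gr)) :
    (forall j, psi j 0 = v (near_coord j) 0) ->
    (forall i, - psi (inr i) (edge_length i) = v (far_coord i) 0) ->
  trace' psi = v.
Proof.
move=> near_v far_v.
by apply: (@eq_boundary_col (fun e => psi (inl e) 0) (fun i => psi (inr i) 0)
  (fun i => - psi (inr i) (edge_length i))).
Qed.

(** The layered function of this profile has boundary values [f] and inward
    derivatives [- g - k f]. *)
Definition hermite_profile (f g : 'I_(bdim Gr) -> R) : profile := fun j =>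
  (hermite (edge_len j)^-1 (f (near_coord j)) (g (near_coord j)),
   if j is inr i then
     hermite (edge_length i)^-1 (f (far_coord i)) (g (far_coord i)) else 0).

Lemma admissible_hermite f g : admissible (hermite_profile f g).
Proof. by case. Qed.

Lemma hermite_profile_near k f g j :
  edge_layers k (hermite_profile f g) j 0 = f (near_coord j).
Proof.
rewrite /edge_layers /two_layers /layer subr0 hermite0 mulr0 oppr0 expR0 mulr1.
case: j => [e|i] /=; first by rewrite horner0 mul0r addr0.
by rewrite hermite_end ?mul0r ?addr0 // gt_eqF ?edge_length_gt0.
Qed.

Lemma hermite_profile_far k f g i :
  edge_layers k (hermite_profile f g) (inr i) (edge_length i) = f (far_coord i).
Proof.
rewrite /edge_layers /two_layers /layer /= subrr hermite0.
rewrite hermite_end ?gt_eqF ?edge_length_gt0 //.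
by rewrite mulr0 oppr0 expR0 mulr1 mul0r add0r.
Qed.

Lemma hermite_profile_deriv_near k f g j :
  edge_layers k (profile_deriv k (hermite_profile f g)) j 0 =
  - g (near_coord j) - k * f (near_coord j).
Proof.
rewrite /edge_layers /two_layers /layer /= hornerN !horner_layer_deriv.
rewrite subr0 hermite0 hermite_deriv0 mulr0 oppr0 expR0 mulr1.
case: j => [e|i] /=.
  by rewrite deriv0 !horner0 mulr0 subrr oppr0 mul0r addr0.
rewrite hermite_end ?hermite_deriv_end ?gt_eqF ?edge_length_gt0 //.
by rewrite mulr0 subrr oppr0 mul0r addr0.
Qed.

Lemma hermite_profile_deriv_far k f g i :
  - edge_layers k (profile_deriv k (hermite_profile f g)) (inr i)
      (edge_length i) =
  - g (far_coord i) - k * f (far_coord i).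
Proof.
rewrite /edge_layers /two_layers /layer /= hornerN !horner_layer_deriv.
rewrite subrr hermite0 hermite_deriv0.
rewrite hermite_end ?hermite_deriv_end ?gt_eqF ?edge_length_gt0 //.
by rewrite !mulr0 !oppr0 expR0; ring.
Qed.

Lemma complexE_eta (z : R[i]) : (complex.Re z +i* complex.Im z)%C = z.
Proof. by case: z. Qed.

End LayeredFunctions.

(** * Quasimodes *)

Section Quasimode.
Variables (R : realType) (Gr : metric_graph R).
Local Notation mu := (@lebesgue_measure R).
Implicit Types (k t : R) (j : edge Gr) (s b : 'cV[R[i]]_(bdim Gr)).

Definition re_profile s b : profile Gr :=
  hermite_profile (fun n => complex.Re (s n 0)) (fun n => complex.Re (b n 0)).

Definition im_profile s b : profile Gr :=
  hermite_profile (fun n => complex.Im (s n 0)) (fun n => complex.Im (b n 0)).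

Definition quasimode k s b : edge_fun Gr :=
  layered k (re_profile s b) (im_profile s b).

(** The second derivative of [quasimode]. *)
Definition quasimode2 k s b : edge_fun Gr :=
  layered k (profile_deriv k (profile_deriv k (re_profile s b)))
            (profile_deriv k (profile_deriv k (im_profile s b))).

(** The traces are [s] and [- b - k s], and
    [A s + B (- b - k s) = (A s - B b) - k B s] vanishes for a chain at
    infinity, whatever [k]. *)
Lemma quasimode_Delta (A B : 'M[R[i]]_(bdim Gr)) s b k : 1 <= k ->
    A *m s = B *m b -> B *m s = 0 ->
  Delta A B (quasimode k s b, quasimode2 k s b).
Proof.
move=> k1 AsBb Bs0.
exists (layered k (profile_deriv k (re_profile s b))
                  (profile_deriv k (im_profile s b))).
  by apply: layered_H2 => //; exact: admissible_hermite.
have -> : trace (quasimode k s b) = s.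
  apply: eq_trace => [j|i].
    by rewrite /quasimode /layered !hermite_profile_near complexE_eta.
  by rewrite /quasimode /layered !hermite_profile_far complexE_eta.
set psi1 := layered _ _ _.
have -> : trace' psi1 = - b - k%:C *: s.
  apply: eq_trace' => [j|i]; rewrite /psi1 /layered !mxE.
    rewrite !hermite_profile_deriv_near.
    by case: (s _ _) (b _ _) => [? ?] [? ?] /=; simpc.
  rewrite -[- (_ +i* _)]/((- _) +i* (- _)) !hermite_profile_deriv_far.
  by case: (s _ _) (b _ _) => [? ?] [? ?] /=; simpc.
by rewrite mulmxBr mulmxN -scalemxAr Bs0 scaler0 subr0 AsBb subrr.
Qed.

Definition residual k (P : profile Gr) j x : R :=
  2 * k * two_layers k (edge_len j) (P j).1^`() (P j).2^`() x
  - two_layers k (edge_len j) (P j).1^`()^`() (P j).2^`()^`() x.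

Lemma quasimode_residual k s b j x :
  - quasimode2 k s b j x + (k ^+ 2)%:C * quasimode k s b j x =
  residual k (re_profile s b) j x +i* residual k (im_profile s b) j x.
Proof.
rewrite /residual -!two_layers_equation /quasimode /quasimode2 /layered.
by simpc.
Qed.

Lemma far_free_deriv j (r : {poly R}) : far_free j r -> far_free j r^`().
Proof. by case: j => //= _ ->; rewrite deriv0. Qed.

Lemma residual_sqr_le P j : admissible P -> exists2 K, 0 <= K &
  forall k x, 1 <= k -> edge_itv j x ->
    residual k P j x ^+ 2 <= K * k ^+ 2 * decay k j x.
Proof.
move=> aP; have f1 := far_free_deriv (aP j); have f2 := far_free_deriv f1.
have [K1 K10 H1] := two_layers_sqr_le (P j).1^`() f1.
have [K2 K20 H2] := two_layers_sqr_le (P j).1^`()^`() f2.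
exists (8 * K1 + 2 * K2) => [|k x k1 Dx]; first lra.
rewrite /residual; set u := two_layers _ _ _ _ _; set v := two_layers _ _ _ _ _.
have k2 : 1 <= k ^+ 2 by rewrite exprn_ege1.
have Hu : k ^+ 2 * u ^+ 2 <= k ^+ 2 * (K1 * decay k j x).
  by rewrite ler_wpM2l ?sqr_ge0 // H1.
have Hv : v ^+ 2 <= k ^+ 2 * (K2 * decay k j x).
  apply: (le_trans (H2 _ _ k1 Dx)).
  by rewrite ler_peMl // mulr_ge0 // decay_ge0.
have := sqr_ge0 (2 * k * u + v).
have -> : (8 * K1 + 2 * K2) * k ^+ 2 * decay k j x =
  8 * (k ^+ 2 * (K1 * decay k j x)) + 2 * (k ^+ 2 * (K2 * decay k j x)) by ring.
have -> : (2 * k * u - v) ^+ 2 =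
  8 * (k ^+ 2 * u ^+ 2) + 2 * v ^+ 2 - (2 * k * u + v) ^+ 2 by ring.
lra.
Qed.

Lemma hermite_profileZ t f g (j : edge Gr) :
  hermite_profile (fun n => t * f n) (fun n => t * g n) j =
  (t *: (hermite_profile f g j).1, t *: (hermite_profile f g j).2).
Proof.
rewrite /hermite_profile hermiteZ.
by case: j => // i; rewrite ?hermiteZ ?scaler0.
Qed.

Lemma re_profileZ t s b j : re_profile (t%:C *: s) (t%:C *: b) j =
  (t *: (re_profile s b j).1, t *: (re_profile s b j).2).
Proof.
rewrite -hermite_profileZ; congr (hermite_profile _ _ j); apply/funext => n.
  by rewrite mxE; case: (s n 0) => ? ? /=; rewrite mul0r subr0.
by rewrite mxE; case: (b n 0) => ? ? /=; rewrite mul0r subr0.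
Qed.

Lemma im_profileZ t s b j : im_profile (t%:C *: s) (t%:C *: b) j =
  (t *: (im_profile s b j).1, t *: (im_profile s b j).2).
Proof.
rewrite -hermite_profileZ; congr (hermite_profile _ _ j); apply/funext => n.
  by rewrite mxE; case: (s n 0) => ? ? /=; rewrite mul0r addr0.
by rewrite mxE; case: (b n 0) => ? ? /=; rewrite mul0r addr0.
Qed.

Lemma residualZ t k (P Q : profile Gr) j x :
    Q j = (t *: (P j).1, t *: (P j).2) ->
  residual k Q j x = t * residual k P j x.
Proof. by rewrite /residual => -> /=; rewrite !derivZ !two_layersZ; ring. Qed.

Lemma continuous_residual k P j : continuous (residual k P j).
Proof.
move=> x; apply: cvgB; last exact: continuous_two_layers.
by apply: cvgM; [exact: cvg_cst|exact: continuous_two_layers].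
Qed.

Definition source k s b : edge_fun Gr :=
  fun j x => - quasimode2 k s b j x + (k ^+ 2)%:C * quasimode k s b j x.

(** The source is [O(k)] on strips of width [k^-1], so its squared norm
    is [O(k)].  The factor [t] allows for the later normalization. *)
Lemma source_upper s b : exists2 S, 0 <= S & forall k t, 1 <= k ->
  \sum_j \int[mu]_(x in edge_itv j)
     (Normc.normc (source k (t%:C *: s) (t%:C *: b) j x) ^+ 2)
  <= S * t ^+ 2 * k.
Proof.
have /choice[K HK] : forall j, exists K, 0 <= K /\
    forall k x, 1 <= k -> edge_itv j x ->
   residual k (re_profile s b) j x ^+ 2 + residual k (im_profile s b) j x ^+ 2
   <= K * k ^+ 2 * decay k j x.
  move=> j; have [K1 K10 H1] := residual_sqr_le j (@admissible_hermite R Gr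
    (fun n => complex.Re (s n 0)) (fun n => complex.Re (b n 0))).
  have [K2 K20 H2] := residual_sqr_le j (@admissible_hermite R Gr
    (fun n => complex.Im (s n 0)) (fun n => complex.Im (b n 0))).
  exists (K1 + K2); split=> [|k x k1 Dx]; first exact: addr_ge0.
  by rewrite !mulrDl lerD ?H1 ?H2.
exists (\sum_j 2 * K j) => [|k t k1].
  by apply: sumr_ge0 => j _; rewrite mulr_ge0 //; case: (HK j).
rewrite !mulr_suml; apply: ler_sum => j _.
have [Kj0 HKj] := HK j.
have k0 : 0 < k by exact: lt_le_trans k1.
under eq_Rintegral => x _ do
  rewrite /source quasimode_residual normc_sqr
    (residualZ _ _ (re_profileZ t s b j)) (residualZ _ _ (im_profileZ t s b j))
    !exprMn -mulrDr.
apply: (@le_trans _ _ ((t ^+ 2 * (K j * k ^+ 2)) * (2 / k))); last first.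
  by rewrite le_eqVlt; apply/orP; left; apply/eqP; field; rewrite gt_eqF.
apply: Rintegral_le_decay => //.
- by rewrite mulr_ge0 ?sqr_ge0 // mulr_ge0 ?sqr_ge0.
- move=> x; apply: cvgM; first exact: cvg_cst.
  by apply: continuous_sqrD; exact: continuous_residual.
- move=> x Dx; rewrite mulr_ge0 ?addr_ge0 ?sqr_ge0 //=.
  rewrite -(mulrA (t ^+ 2) (K j * k ^+ 2)).
  by rewrite ler_wpM2l ?sqr_ge0 // HKj.
Qed.

Lemma Rintegral_normc_ge (D : set R) (f : R -> R[i]) (x y m : R) :
    measurable D -> square_integrable D f -> x <= y -> `[x, y] `<=` D ->
    0 <= m -> (forall z, x <= z <= y -> m <= complex.Re (f z)) ->
  m ^+ 2 * (y - x) <= \int[mu]_(z in D) (Normc.normc (f z) ^+ 2).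
Proof.
move=> mD [_ _ intf] xy sD m0 fm.
have muxy : mu `[x, y]%classic = (y - x)%:E.
  rewrite lebesgue_measure_itv /= lte_fin; case: ltP => [_|yx] //.
  by rewrite (le_anti (introT andP (conj xy yx))) subrr.
have intm : (\int[mu]_(z in `[x, y]) (m ^+ 2)%:E = (m ^+ 2 * (y - x))%:E)%E.
  by rewrite integral_cst //= muxy EFinM.
have -> : m ^+ 2 * (y - x) = fine (\int[mu]_(z in `[x, y]) (m ^+ 2)%:E)%E.
  by rewrite intm.
rewrite /Rintegral fine_le //.
- by rewrite intm.
- exact: integrable_fin_num.
- apply: (@le_trans _ _
      (\int[mu]_(z in `[x, y]) (Normc.normc (f z) ^+ 2)%:E)%E).
    apply: ge0_le_integral => //.
    + by move=> z _; rewrite lee_fin sqr_ge0.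
    + by move/measurable_int: intf => mf; apply: measurable_funS mf.
    + move=> z; rewrite /= in_itv /= => /fm; rewrite lee_fin.
      case: (f z) => u v /= mu_; rewrite normc_sqr.
      by rewrite ler_wpDr ?sqr_ge0 // lerXn2r ?nnegrE // (le_trans m0).
  apply: ge0_subset_integral => //.
  + by move/measurable_int: intf.
  + by move=> z _; rewrite lee_fin sqr_ge0.
Qed.

Lemma quasimode_re_ge_near s b j : s (near_coord j) 0 = 1 ->
  exists2 k0, 0 < k0 & forall k t x, k0 <= k -> 0 <= t -> 0 <= x <= k^-1 ->
    t * (expR (-1) / 2) <= complex.Re (quasimode k (t%:C *: s) (t%:C *: b) j x).
Proof.
move=> s1; pose P := re_profile s b j.
have P1 : P.1.[0] = 1 by rewrite hermite0 s1.
have far : 0 < edge_len j \/ P.2 = 0.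
  rewrite /P; case: j {P P1 s1} => [e|i]; first by right.
  by left; exact: edge_length_gt0.
have [k0 k00 H] := two_layers_ge P1 far.
exists k0 => // k t x kk0 t0 Hx.
by rewrite /= /edge_layers re_profileZ two_layersZ ler_wpM2l // H.
Qed.

Lemma quasimode_re_ge_far s b i : s (far_coord i) 0 = 1 ->
  exists2 k0, 0 < k0 & forall k t x, k0 <= k -> 0 <= t ->
    edge_length i - k^-1 <= x <= edge_length i ->
    t * (expR (-1) / 2) <=
      complex.Re (quasimode k (t%:C *: s) (t%:C *: b) (inr i) x).
Proof.
move=> s1; pose P := re_profile s b (inr i).
have P1 : P.2.[0] = 1 by rewrite hermite0 s1.
have [k0 k00 H] :=
  @two_layers_ge R P.2 P.1 _ P1 (or_introl (edge_length_gt0 i)).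
exists k0 => // k t x kk0 t0 Hx.
rewrite /= /edge_layers re_profileZ two_layersZ two_layersC ler_wpM2l //.
by apply: H => //=; move: Hx; rewrite subr_ge0 lerBlDr lerBlDl => /andP[-> ->].
Qed.

(** A single coordinate of [s] equal to [1] already keeps the quasimode of order
    one on the strip of width [k^-1] at the corresponding end. *)
Lemma quasimode_lower s b n : s n 0 = 1 ->
  exists2 k0, 1 <= k0 & forall k t, k0 <= k -> 0 <= t ->
  (t * (expR (-1) / 2)) ^+ 2 / k <= \sum_j \int[mu]_(x in edge_itv j)
     (Normc.normc (quasimode k (t%:C *: s) (t%:C *: b) j x) ^+ 2).
Proof.
have itv_sub i (k : R) : (edge_length i)^-1 <= k -> 0 < k ->
    k^-1 <= @edge_length _ Gr i.
  move=> lk k0.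
  by rewrite -[leRHS]invrK lef_pV2 ?posrE ?invr_gt0 ?edge_length_gt0.
(* It suffices to find a strip of width [k^-1] in one edge on which the real
   part is at least [t / (2 e)]. *)
suff main j : (exists2 k0, 1 <= k0 & forall k t, k0 <= k -> 0 <= t ->
  exists2 x, `[x, x + k^-1] `<=` edge_itv j & forall z, x <= z <= x + k^-1 ->
    t * (expR (-1) / 2) <=
      complex.Re (quasimode k (t%:C *: s) (t%:C *: b) j z)) ->
  exists2 k0, 1 <= k0 & forall k t, k0 <= k -> 0 <= t ->
  (t * (expR (-1) / 2)) ^+ 2 / k <= \sum_j \int[mu]_(x in edge_itv j)
     (Normc.normc (quasimode k (t%:C *: s) (t%:C *: b) j x) ^+ 2).
  case: (coordP n) => [[j ->]|[i ->]] s1.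
    apply: (main j); have [k0 k00 H] := quasimode_re_ge_near b s1.
    exists (1 + k0 + (edge_len j)^-1) => [|k t].
      rewrite -addrA lerDl addr_ge0 ?(ltW k00) // invr_ge0.
      by case: j {s1 H} => //= i; rewrite ltW ?edge_length_gt0.
    have l0 : 0 <= (edge_len j)^-1.
      rewrite invr_ge0.
      by case: j {s1 H} => //= i; rewrite ltW ?edge_length_gt0.
    move=> kk t0; exists 0; last first.
      by move=> z; rewrite add0r; apply: H => //; lra.
    move=> z; rewrite /= in_itv /= add0r => /andP[z0 zk].
    case: j l0 kk {s1 H} => [e|i] /= l0 kk; rewrite in_itv /= z0 //=.
    by apply: le_trans zk _; apply: itv_sub; lra.
  apply: (main (inr i)); have [k0 k00 H] := quasimode_re_ge_far b s1.
  have l0 : 0 < (edge_length i)^-1 by rewrite invr_gt0 edge_length_gt0.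
  exists (1 + k0 + (edge_length i)^-1) => [|k t kk t0]; first lra.
  exists (edge_length i - k^-1) => z.
    rewrite /= !in_itv /= subrK => /andP[z0 ->]; rewrite andbT.
    by apply: le_trans z0; rewrite subr_ge0 itv_sub //; lra.
  by rewrite subrK; apply: H => //; lra.
move=> [k0 k01 H]; exists k0 => // k t kk t0.
have [x sub H'] := H _ _ kk t0.
have k1 : 1 <= k by exact: le_trans kk.
have k0' : 0 < k^-1 by rewrite invr_gt0 (lt_le_trans _ k1).
rewrite (bigD1 j) //; apply: ler_wpDr.
  by apply: sumr_ge0 => i _; apply: Rintegral_ge0 => z _; exact: sqr_ge0.
have -> : k^-1 = x + k^-1 - x by rewrite addrAC subrr add0r.
apply: Rintegral_normc_ge => //.
- exact: measurable_edge_itv.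
- by apply: layered_L2 => //; exact: admissible_hermite.
- by rewrite lerDl ltW.
- by rewrite mulr_ge0 // mulr_ge0 ?expR_ge0.
Qed.

End Quasimode.

Theorem lemma4p11 (R : realType) (Gr : metric_graph R)
    (A B : 'M[R[i]]_(bdim Gr)) :
  regular A B -> ~ quasi_sectorial A B ->
  exists2 C : R, 0 < C &
    exists kappa0 : R, forall kappa : R, 0 < kappa -> kappa0 <= kappa ->
      ((C / kappa)%:E <=
         opnorm (inverse (opp_shift (Delta A B) (kappa ^+ 2)%:C)))%E.
Proof.
move=> regAB nqsAB.
have [s [b [n [AsBb Bs0 sn1]]]] := exists_chain_at_infinity regAB nqsAB.
have [S S0 upper] := source_upper s b.
have [k0 k01 lower] := quasimode_lower b sn1.
have S10 : 0 < S + 1 by lra.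
pose T := Num.sqrt (S + 1); have T0 : 0 < T by rewrite sqrtr_gt0.
exists (expR (-1) / 2 / T); first by rewrite !divr_gt0 ?expR_gt0.
exists k0 => k kgt0 kk0; have k1 : 1 <= k by exact: le_trans kk0.
(* This factor makes the norm of the source at most [1]; the bound [S + 1]
   replaces [S], which may vanish. *)
pose t := (T * Num.sqrt k)^-1.
have t0 : 0 <= t by rewrite invr_ge0 mulr_ge0 ?sqrtr_ge0.
have t2 : t ^+ 2 = ((S + 1) * k)^-1.
  by rewrite exprVn exprMn !sqr_sqrtr // ltW.
have AtsBtb : A *m (t%:C *: s) = B *m (t%:C *: b).
  by rewrite -!scalemxAr AsBb.
have Bts0 : B *m (t%:C *: s) = 0 by rewrite -scalemxAr Bs0 scaler0.
pose psi := quasimode k (t%:C *: s) (t%:C *: b).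
apply: (@le_trans _ _ (L2norm psi)%:E).
  rewrite lee_fin -[leLHS]ger0_norm; last first.
    by rewrite !divr_ge0 ?expR_ge0 ?sqrtr_ge0 // ltW.
  rewrite -sqrtr_sqr /L2norm ler_wsqrtr //.
  apply: le_trans (lower k t kk0 t0).
  rewrite [in leRHS]exprMn t2 !expr_div_n [T ^+ 2]sqr_sqrtr; last exact: ltW.
  by rewrite le_eqVlt; apply/orP; left; apply/eqP; field; rewrite !gt_eqF.
apply: ereal_sup_ubound; exists (source k (t%:C *: s) (t%:C *: b), psi) => //.
split=> /=.
  exists (quasimode2 k (t%:C *: s) (t%:C *: b)) => //=.
  exact: quasimode_Delta.
rewrite /L2norm -sqrtr1 ler_wsqrtr //.
apply: (le_trans (upper k t k1)).
by rewrite t2 invfM mulrA mulfVK ?gt_eqF // ler_pdivrMr // mul1r lerDl.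
Qed.
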